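(* Let $P$ be a partition of $S_c$ and $C$ a straightening set of $P$ such that $P$ is $C$-confluent. Suppose that whenever two $P$-hits $h$ and $h'$ in a permutation $w\in S_n$ overlap (share a position), at least one of $h,h'$ is $(P,C)$-straightened. Let $k=c!-|P|$, where $|P|$ is the number of parts of $P$. Then the number of equivalence classes of $S_n$ under the $P$-equivalence is $$\sum_{j\ge0,\ cj\le n}\frac{(-1)^j\,((n-cj+j)!)^2\,k^j}{j!\,(n-cj)!}.$$
   Context: Fix positive integers $c\le n$. $S_m$ is the set of permutations of $\{1,\dots,m\}$ written as words. A word $w_1\cdots w_c$ (distinct integer letters) forms $u\in S_c$ if there is an integer $k$ with $w_i=u_i+k$ for all $i$. A hit in $w\in S_n$ is a contiguous subword of length $c$ forming some $u\in S_c$. For a partition $P$ of a subset of $S_c$, a $P$-hit is a hit forming a permutation in some part of $P$; a $P$-rearrangement rearranges the letters of a $P$-hit in place so that the new subword forms a permutation in the same part of $P$. The $P$-equivalence on $S_n$ is the reflexive-transitive closure of $P$-rearrangement; its classes are the equivalence classes. Tail size of a word $w$ of length $m$ with distinct letters: least $k\ge1$ such that the first $k$ letters are the $k$ smallest letters of $w$. $w$ is right leaning if its tail size is $<m$, left leaning if its reversal has tail size $<m$, omni leaning if neither. Polarization of a hit $h$ in $w\in S_n$: if $h$ is all of $w$, $h$ is left polarized. Otherwise let $a$ be the average of the letters of $h$, $w'$ be $w$ with $h$ replaced by the single letter $a$, and $b$ the letter adjacent to $a$ in $w'$ closest in value to $a$ (ties: the left one). If $a,b$ appear in increasing order in $w'$,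 $h$ is right polarized; if decreasing, left polarized. A hit is backward if it is right polarized and left leaning, or left polarized and right leaning, or omni leaning; otherwise forward. A straightening set $C$ of $P$ is a set of permutations from the parts of $P$ containing exactly: one left leaning permutation from each part containing a left leaning permutation, one right leaning permutation from each part containing a right leaning permutation, and one permutation from each part containing only omni leaning permutations. A $P$-hit $h$ is $(P,C)$-straightened if it forms a permutation in $C$ and either it is forward, or it is backward and no $P$-rearrangement of $h$ makes it forward. $(P,C)$-straightening a $P$-hit means applying a $P$-rearrangement so it becomes $(P,C)$-straightened. The $(P,C)$-straightening operator $\to$ on $S_n$: $w\to w'$ iff $w'$ is obtained from $w$ by $(P,C)$-straightening a not-yet-$(P,C)$-straightened $P$-hit of $w$. A relation $\to$ on a finite set $A$ with reflexive-transitive closure $\to'$ is confluent if there are no distinct $a,b$ with $a\to'b$ and $b\to'a$, and each connected component $K$ of $(A,\to)$ has a unique node $m$ with $x\to'm$ for all $x\in K$. $P$ is $C$-confluent if the $(P,C)$-straightening operator on $S_n$ is confluent. *)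

(* Defs.v *)
From HB Require Import structures.
From mathcomp Require Import all_boot all_order all_fingroup all_algebra.
From mathcomp Require Import zify.

Set Implicit Arguments.
Unset Strict Implicit.
Unset Printing Implicit Defensive.

Import Order.TTheory GRing.Theory Num.Theory.

(* Letters and positions are numbered from 0: 'S_m is the set of permutations
   of {0, ..., m-1}.  All the notions below are invariant under translation of
   the letters. *)

Definition word m (w : 'S_m) : seq nat := [seq val (w i) | i <- enum 'I_m].

Definition subword c (s : seq nat) (p : nat) : seq nat := take c (drop p s).

(* v = u + k for some integer k.  Since the letter 0 occurs in u, the shift k is
   itself a letter of v, hence the bound; see formsP. *)
Definition forms c (v : seq nat) (u : 'S_c) : bool :=
  [exists k : 'I_(\max_(x <- v) x).+1, v == [seq x + k | x <- word u]].

Lemma size_word m (w : 'S_m) : size (word w) = m.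
Proof. by rewrite size_map size_enum_ord. Qed.

Lemma nth_word m (w : 'S_m) (i : 'I_m) : nth 0 (word w) i = w i.
Proof. by rewrite (nth_map i) ?size_enum_ord // nth_ord_enum. Qed.

Lemma formsP c (v : seq nat) (u : 'S_c) : 0 < c ->
  reflect (exists k : int, size v = c /\
             forall i : 'I_c, ((nth 0%N v i)%:Z = (u i)%:Z + k)%R)
          (forms v u).
Proof.
case: c u => // c u _; apply: (iffP existsP).
- case=> -[k /= _] /eqP ev; exists (Posz k); split.
    by rewrite ev size_map size_word.
  move=> i; rewrite ev (nth_map 0) ?size_word // nth_word; lia.
- case=> k [sz h]; pose i0 := (u^-1)%g ord0.
  have hk : ((nth 0%N v i0)%:Z = k)%R by rewrite h permKV add0r.
  have lek : nth 0 v i0 < (\max_(x <- v) x).+1.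
    by rewrite ltnS; apply: leq_bigmax_seq => //; rewrite mem_nth // sz.
  exists (Ordinal lek); apply/eqP/(@eq_from_nth _ 0).
    by rewrite size_map size_word.
  move=> i; rewrite sz => lti.
  rewrite (nth_map 0) ?size_word //= (nth_word u (Ordinal lti)).
  have /= := h (Ordinal lti); lia.
Qed.

Definition tail_at (v : seq nat) (k : nat) : bool :=
  (0 < k) && perm_eq (take k v) (take k (sort leq v)).

(* [find] returns the least k in 0, 1, ..., size v satisfying [tail_at v]. *)
Definition tail_size (v : seq nat) : nat :=
  find (tail_at v) (iota 0 (size v).+1).

Definition right_leaning (v : seq nat) : bool := tail_size v < size v.
Definition left_leaning (v : seq nat) : bool := tail_size (rev v) < size v.
Definition omni_leaning (v : seq nat) : bool :=
  ~~ right_leaning v && ~~ left_leaning v.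

Section Hits.
Variables n c : nat.
Implicit Types (w : 'S_n) (p : 'I_(n - c).+1).
Implicit Types (P : {set {set 'S_c}}) (C : {set 'S_c}).

(* For c <= n, an index p : 'I_(n - c).+1 is the starting position of a
   contiguous subword of length c. *)
Definition at_pos w p : seq nat := subword c (word w) p.

Definition P_hit P w p : bool :=
  [exists B in P, exists u in B, forms (at_pos w p) u].

Definition P_rearr_at P p w w' : bool :=
  [&& take p (word w') == take p (word w),
      drop (p + c) (word w') == drop (p + c) (word w),
      perm_eq (at_pos w' p) (at_pos w p)
    & [exists B in P, [exists u in B, forms (at_pos w p) u] &&
                      [exists u' in B, forms (at_pos w' p) u']]].

Definition P_rearrangement P : rel 'S_n :=
  fun w w' => [exists p, P_rearr_at P p w w'].

Definition P_equiv P : rel 'S_n := connect (P_rearrangement P).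

Definition P_classes P : {set {set 'S_n}} :=
  equivalence_partition (P_equiv P) [set: 'S_n].

Definition average (v : seq nat) : rat :=
  ((\sum_(x <- v) x%:R) / (size v)%:R)%R.

(* The word w' in which the hit at p is replaced by its average. *)
Definition contract w p : seq rat :=
  [seq (x%:R)%R | x <- take p (word w)] ++
  average (at_pos w p) :: [seq (x%:R)%R | x <- drop (p + c) (word w)].

Definition closest_is_left w p : bool :=
  let a := nth 0%R (contract w p) p in
  let l := nth 0%R (contract w p) p.-1 in
  let r := nth 0%R (contract w p) p.+1 in
  (0 < p) && ((p + c == n) || (`|l - a| <= `|r - a|)%R).

Definition right_polarized w p : bool :=
  let a := nth 0%R (contract w p) p in
  let l := nth 0%R (contract w p) p.-1 in
  let r := nth 0%R (contract w p) p.+1 in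
  (c != n) && (if closest_is_left w p then l < a else a < r)%R.

Definition left_polarized w p : bool :=
  let a := nth 0%R (contract w p) p in
  let l := nth 0%R (contract w p) p.-1 in
  let r := nth 0%R (contract w p) p.+1 in
  (c == n) || (if closest_is_left w p then a < l else r < a)%R.

Definition backward w p : bool :=
  [|| right_polarized w p && left_leaning (at_pos w p),
      left_polarized w p && right_leaning (at_pos w p)
    | omni_leaning (at_pos w p)].

Definition forward w p : bool := ~~ backward w p.

Definition straightened P C w p : bool :=
  [&& P_hit P w p, [exists u in C, forms (at_pos w p) u] &
      forward w p ||
      (backward w p && ~~ [exists w', P_rearr_at P p w w' && forward w' p])].

Definition straightening_step P C : rel 'S_n :=
  fun w w' => [exists p, [&& P_hit P w p, ~~ straightened P C w p,
                             P_rearr_at P p w w' & straightened P C w' p]].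

Definition overlap (p q : 'I_(n - c).+1) : bool :=
  [exists i : 'I_n, (p <= i < p + c) && (q <= i < q + c)].

End Hits.

(* The cardinals on the left are compared with booleans, coerced to 0 or 1. *)
Definition straightening_set c (P : {set {set 'S_c}}) (C : {set 'S_c}) : Prop :=
  C \subset cover P /\
  forall B, B \in P ->
    [/\ #|[set u in B :&: C | left_leaning (word u)]|
          = [exists u in B, left_leaning (word u)],
        #|[set u in B :&: C | right_leaning (word u)]|
          = [exists u in B, right_leaning (word u)]
      & #|[set u in B :&: C | omni_leaning (word u)]|
          = [forall u in B, omni_leaning (word u)]].

Definition components (T : finType) (r : rel T) : {set {set T}} :=
  equivalence_partition (connect (fun x y => r x y || r y x)) [set: T].

Definition confluent (T : finType) (r : rel T) : Prop :=
  (forall a b, connect r a b -> connect r b a -> a = b) /\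
  (forall K, K \in components r ->
     exists! m, m \in K /\ forall x, x \in K -> connect r x m).

Definition C_confluent n c (P : {set {set 'S_c}}) (C : {set 'S_c}) : Prop :=
  confluent (@straightening_step n c P C).

(* Main.v *)
Require Import Defs.
From HB Require Import structures.
From mathcomp Require Import all_boot all_order all_fingroup all_algebra.
From mathcomp Require Import zify ring lra.

Set Implicit Arguments.
Unset Strict Implicit.
Unset Printing Implicit Defensive.

Import Order.TTheory GRing.Theory Num.Theory.

(* Call a hit unstraightened if it is not (P,C)-straightened. By confluence,
   the number of classes is the number of sinks of the straightening operator,
   i.e., of words without unstraightened hits; by inclusion-exclusion, it is
   the alternating sum over sets J of positions of the number of words
   unstraightened at every position of J.

   The key remark is that a hit is right polarized exactly when (left
   neighbour, hit, right neighbour) is increasing up to a cyclic rotation. As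
   the letters of a hit form an interval, permuting them changes neither the
   polarization of that hit nor that of a hit disjoint from it. Each part
   contains exactly one straightened form for each polarization, so k of the
   c! fillings of a hit are unstraightened, independently of the fillings of
   the other hits in J.

   By hypothesis only the sets J of pairwise disjoint hits contribute. For |J|
   = j there are 'C(n - cj + j, j) of them. Requiring instead that the hits be
   filled by the identity turns the count into that of the permutations with
   (c-1)j prescribed successions w (i+1) = w i + 1, i.e., (n - (c-1)j)!. *)

(** * Leaning *)

(** Translation commutes with sorting; hence leaning depends only on the permutation that a hit
    forms. *)
Lemma tail_size_addn k v : tail_size [seq x + k | x <- v] = tail_size v.
Proof.
rewrite /tail_size size_map; apply: eq_find => j; rewrite /tail_at.
have -> : sort leq [seq x + k | x <- v] = [seq x + k | x <- sort leq v].
  apply: (sorted_eq leq_trans anti_leq); first exact/sort_sorted/leq_total.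
    rewrite (@mono_sorted _ _ _ leq) => [|x y]; last by rewrite leq_add2r.
    exact/sort_sorted/leq_total.
  by rewrite perm_sort; apply: perm_map; rewrite perm_sym perm_sort.
rewrite -!map_take; congr (_ && _); apply/idP/idP; last exact: perm_map.
exact/perm_map_inj/addIn.
Qed.

Lemma right_leaning_addn k v :
  right_leaning [seq x + k | x <- v] = right_leaning v.
Proof. by rewrite /right_leaning tail_size_addn size_map. Qed.

Lemma left_leaning_addn k v :
  left_leaning [seq x + k | x <- v] = left_leaning v.
Proof. by rewrite /left_leaning -map_rev tail_size_addn size_map. Qed.

Lemma tail_at_tail_size v : right_leaning v -> tail_at v (tail_size v).
Proof.
rewrite /right_leaning /tail_size => lt_tail.
have lt_find :
  find (tail_at v) (iota 0 (size v).+1) < size (iota 0 (size v).+1).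
  by rewrite size_iota; lia.
have := lt_find; rewrite -has_find => /(nth_find 0).
by rewrite nth_iota //; move: lt_find; rewrite size_iota.
Qed.

(** The first letter of [v] is among its [k] smallest, hence among its [j] smallest. If these were
    the last [j] letters of [v], it would occur twice, since [j < size v]. *)
Lemma tails_disjoint v k j : uniq v -> k <= j -> j < size v ->
  tail_at v k -> ~~ tail_at (rev v) j.
Proof.
move=> uniq_v le_kj lt_jv /andP[k_gt0 tail_k]; apply/negP => /andP[_].
have -> : sort leq (rev v) = sort leq v.
  by apply/perm_sortP; rewrite ?perm_rev //;
    [exact: leq_total | exact: leq_trans | exact: anti_leq].
case: v uniq_v lt_jv tail_k => // x v; case: k k_gt0 le_kj => // k _ le_kj.
move=> uniq_v lt_jv tail_k tail_j.
have: x \in take j (rev (x :: v)).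
  rewrite (perm_mem tail_j)
    -(cat_take_drop k.+1 (take j _)) mem_cat take_takel //.
  by rewrite -(perm_mem tail_k) mem_head.
rewrite take_rev mem_rev; case dj: (_ - _) => [|d]; first by lia.
by rewrite /= => /mem_drop; apply/negP; case/andP: uniq_v.
Qed.

Lemma leaning_exclusive v : uniq v -> right_leaning v -> ~~ left_leaning v.
Proof.
move=> uniq_v right_v; apply/negP => left_v.
have tail_v := tail_at_tail_size right_v.
have lt_tail : tail_size (rev v) < size v by [].
have := @tail_at_tail_size (rev v); rewrite /right_leaning size_rev.
move=> /(_ left_v) tail_rev.
(* The shorter tail takes the place of [k] in [tails_disjoint], applied to [v] or to its
   reversal. *)
case: (leqP (tail_size v) (tail_size (rev v))) => [le|lt].
  by have /negP := tails_disjoint uniq_v le lt_tail tail_v.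
have := @tails_disjoint (rev v) _ (tail_size v) _ (ltnW lt) _ tail_rev.
by rewrite rev_uniq size_rev revK => /(_ uniq_v right_v); rewrite tail_v.
Qed.

Lemma word_uniq m (w : 'S_m) : uniq (word w).
Proof.
by rewrite map_inj_uniq ?enum_uniq //; apply: inj_comp val_inj perm_inj.
Qed.

(** If [a] lies between [l] and [r], both neighbours give the same answer. If both lie on one side
    of [a], the closest one is next to [a] in value, and this fixes the cyclic order. Distances thus
    give way to comparisons. *)
Lemma closest_cyclic (R : realDomainType) (l a r : R) :
    l != a -> r != a -> l != r ->
  ((if `|l - a| <= `|r - a| then l < a else a < r)
    = [|| l < a < r, r < l < a | a < r < l])%R.
Proof.
have distE (x : R) : (`|x - a| = if x < a then a - x else x - a)%R.
  by case: ltP => ?;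
    [rewrite ltr0_norm ?opprB ?subr_lt0|rewrite ger0_norm ?subr_ge0].
rewrite !distE; case: (ltgtP l a) => // la _; case: (ltgtP r a) => // ra _;
  case: (ltgtP l r) => // lr _ /=; rewrite ?if_same //; try (exfalso; lra).
all: case: leP => // le; exfalso; lra.
Qed.

(** * Sinks of a confluent relation *)

(** The node that all of a component reaches is a sink: a step out of it could be followed back,
    against antisymmetry. A sink reaches only itself, so a component has no second one. *)
Lemma card_components (T : finType) (r : rel T) :
    (forall x y, r x y -> x != y) -> confluent r ->
  #|components r| = #|[set x | [forall y, ~~ r x y]]|.
Proof.
move=> r_irr [r_anti r_sink]; pose e := connect (fun x y => r x y || r y x).
have e_sym : connect_sym (fun x y => r x y || r y x).
  by apply: sym_connect_sym => x y; rewrite orbC.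
have e_r x y : r x y -> e x y by move=> rxy; apply: connect1; rewrite rxy.
pose f x := [set y in [set: T] | e x y].
have fP x y : (y \in f x) = e x y by rewrite !inE.
have eq_f x y : e x y -> f x = f y.
  by move=> exy; apply/setP => z; rewrite !fP; apply: same_connect.
have f_comp x : f x \in components r by apply/imsetP; exists x; rewrite ?inE.
have sink_max x m : [forall y, ~~ r x y] -> connect r x m -> x = m.
  move=> /forallP sink_x /connectP[[|y s] //= /andP[rxy _] _].
  by have := sink_x y; rewrite rxy.
have f_inj : {in [set x | [forall y, ~~ r x y]] &, injective f}.
  move=> x y; rewrite !inE => sink_x sink_y eq_fxy.
  have [m [[_ max_m] _]] := r_sink _ (f_comp x).
  have xm : connect r x m by apply: max_m; rewrite fP; exact: connect0.
  have ym : connect r y m by apply: max_m; rewrite eq_fxy fP; exact: connect0.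
  by rewrite (sink_max x m sink_x xm) (sink_max y m sink_y ym).
rewrite -(card_in_imset f_inj); apply: eq_card => K; apply/idP/imsetP.
  case/imsetP=> x _ ->; have [m [[xm max_m] _]] := r_sink _ (f_comp x).
  rewrite fP in xm; exists m; last exact: eq_f.
  rewrite inE; apply/forallP => y; apply/negP => rmy.
  have ym : connect r y m.
    by apply: max_m; rewrite fP; apply: connect_trans xm (e_r _ _ rmy).
  by have := r_irr _ _ rmy; rewrite (r_anti _ _ (connect1 rmy) ym) eqxx.
by case=> x _ ->.
Qed.

(** * Enumeration lemmas *)

Lemma lift_perm_surj n (w : 'S_n.+1) (i : 'I_n.+1) :
  exists s : 'S_n, w = lift_perm i (w i) s.
Proof.
(* As [lift i j] differs from [i], its letter differs from [w i] and [unlift] succeeds; the default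
   [j] is a dummy. *)
pose f j := odflt j (unlift (w i) (w (lift i j))).
have fE j : lift (w i) (f j) = w (lift i j).
  rewrite /f; case: unliftP => //= /perm_inj lift_eq.
  by have := neq_lift i j; rewrite lift_eq eqxx.
have f_inj : injective f.
  move=> j1 j2 eq_f; apply: (@lift_inj _ i); apply: (@perm_inj _ w).
  by rewrite -!fE eq_f.
exists (perm f_inj); apply/permP => x; case: (unliftP i x) => [j|] ->.
  by rewrite lift_perm_lift permE fE.
by rewrite lift_perm_id.
Qed.

Lemma nth_word_lt m (w : 'S_m) i (lt_im : i < m) :
  nth 0 (word w) i = w (Ordinal lt_im).
Proof. exact: nth_word w (Ordinal lt_im). Qed.

(* [F] doubles a letter: it inserts after position i the letter s i + 1 and
   shifts the larger letters up. *)
Lemma card_successions n (l : seq nat) :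
  sorted gtn l -> all (fun i => i.+1 < n) l ->
  #|[set w : 'S_n |
      all (fun i => nth 0 (word w) i.+1 == (nth 0 (word w) i).+1) l]|
    = (n - size l)`!.
Proof.
elim: l n => [|i l IHl] n sorted_l.
  rewrite subn0 -[RHS](card_Sn) => _.
  by apply: eq_card => w; rewrite !inE.
case: n => [|n] //= /andP[lt_i ltl].
(* Since [l] is decreasing, the remaining conditions concern positions at most [i], which an
   insertion at [i.+1] does not move. *)
have lt_l x : x \in l -> x < i.
  move: x; apply/allP/(@order_path_min _ gtn) => // a b c; rewrite /=; lia.
pose i0 : 'I_n := Ordinal (lt_i : i < n).
pose i1 : 'I_n.+1 := Ordinal (lt_i : i.+1 < n.+1).
pose F (s : 'S_n) := lift_perm i1 (lift ord0 (s i0)) s.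
have F_inj : injective F.
  move=> s t eqF; have eq0 : s i0 = t i0.
    apply: (@lift_inj _ ord0).
    by have := congr1 (fun w : 'S__ => w i1) eqF; rewrite !lift_perm_id.
  apply/permP => j; apply: (@lift_inj _ (lift ord0 (s i0))).
  have := congr1 (fun w : 'S__ => w (lift i1 j)) eqF.
  by rewrite !lift_perm_lift -eq0.
have FE s x (lt_xn : x < n) : x <= i ->
    nth 0 (word (F s)) x = bump (s i0).+1 (nth 0 (word s) x).
  move=> le_xi; rewrite (nth_word_lt _ lt_xn) (nth_word_lt _ (leqW lt_xn)).
  have -> : Ordinal (leqW lt_xn) = lift i1 (Ordinal lt_xn).
    by apply: val_inj; rewrite /= /bump; lia.
  by rewrite lift_perm_lift.
have Fi1 s : nth 0 (word (F s)) i.+1 = (s i0).+1.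
  by rewrite (nth_word_lt _ (ltn_ord i1)) (_ : Ordinal _ = i1) ?lift_perm_id //;
     apply: val_inj.
have lt_in : i < n by [].
have s_i s : nth 0 (word s) i = s i0.
  by rewrite (nth_word_lt _ lt_in); congr (val (s _)); apply: val_inj.
rewrite subSS -IHl; last 2 first.
- exact: path_sorted sorted_l.
- by apply/allP => x /lt_l; lia.
rewrite -(card_imset _ F_inj); apply: eq_card => w; rewrite inE.
have tailE s :
    all (fun x => nth 0 (word (F s)) x.+1 == (nth 0 (word (F s)) x).+1) l
    = all (fun x => nth 0 (word s) x.+1 == (nth 0 (word s) x).+1) l.
  apply: eq_in_all => x /lt_l lt_xi.
  rewrite !FE; try lia.
  (* The new letter separates two consecutive letters only if the lower one is [s i]. *)
  have: nth 0 (word s) x != nth 0 (word s) i.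
    rewrite nth_uniq ?size_word; try lia.
    exact: word_uniq.
  rewrite s_i /bump; lia.
apply/idP/imsetP.
  case/andP=> /eqP w_i w_l; have [s ws] := lift_perm_surj w i1.
  have wF : w = F s.
    rewrite {1}ws /F; congr lift_perm; apply: val_inj.
    rewrite /= /bump add1n -s_i.
    have := w_i; rewrite (nth_word_lt _ (ltn_ord i1)).
    rewrite (_ : Ordinal _ = i1); last exact: val_inj.
    move=> e.
    have lt_in1 : i < n.+1 by lia.
    have : nth 0 (word w) i = bump (w i1) (nth 0 (word s) i).
      rewrite (nth_word_lt _ lt_in1) (nth_word_lt _ lt_in).
      have -> : Ordinal lt_in1 = lift i1 (Ordinal lt_in).
        by apply: val_inj; rewrite /= /bump; lia.
      by rewrite {1}ws lift_perm_lift.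
    rewrite /bump; lia.
  by exists s; rewrite // inE -tailE -wF.
case=> s; rewrite inE -tailE => all_s ->.
by rewrite all_s Fi1 FE // s_i /bump ltnn eqxx.
Qed.

Local Open Scope ring_scope.

(** Expand the product over all [x] of 1 - [x in A], which vanishes as soon as [A] has an
    element. *)
Lemma sum_subset_sign (T : finType) (A : {set T}) :
  \sum_(J in {set T} | J \subset A) (-1) ^+ #|J| = (A == set0)%:R :> rat.
Proof.
pose F x : rat := - (x \in A)%:R.
have := bigA_distr 1 (GRing.add : Monoid.add_law 0 *%R) F (fun=> 1).
under [X in _ = X -> _]eq_bigr => J _.
  rewrite -big_mkcond /= (_ : \prod_(x in J) _
    = if J \subset A then (-1) ^+ #|J| else 0); last first.
    case: ifPn => [/subsetP sJA|/subsetPn[x xJ xA]].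
      by rewrite -prodr_const; apply: eq_bigr => x /sJA; rewrite /F => ->.
    by rewrite (bigD1 x) //= /F (negPf xA) oppr0 mul0r.
  over.
move=> sumE; rewrite big_mkcondr -sumE.
have [A0|[x xA]] := set_0Vmem A.
  by rewrite A0 eqxx big1 // => x _ /=; rewrite /F A0 in_set0 oppr0 add0r.
have -> : (A == set0) = false by apply/negbTE/set0Pn; exists x.
by rewrite (bigD1 x) //= /F xA addNr mul0r.
Qed.

Local Close Scope ring_scope.

(** Pascal's rule, by induction on the bound [b] for the right ends: the last admissible position
    [b.+1 - c] is either absent, which lowers the bound to [b], or present, which confines the other
    hits to [b.+1 - c]. The conditional is there because truncated subtraction would give 'C(j, j) =
    1 where there is no such set. *)
Lemma card_spread m c j b : 0 < c -> b < m + c ->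
  #|[set J : {set 'I_m} | [&& #|J| == j,
       [forall p in J, p + c <= b] &
       [forall p in J, forall q in J, (p < q) ==> (p + c <= q)]]]|
  = if c * j <= b then 'C(b - c * j + j, j) else 0.
Proof.
move=> c_gt0; elim/ltn_ind: b j => -[|b] IHb j le_bm; case: j => [|j].
1,3: (by rewrite muln0 bin0; apply/eqP/cards1P; exists set0; apply/setP => J;
  rewrite !inE cards_eq0; apply/idP/idP => [/andP[]//|/eqP->]; rewrite eqxx /=;
  apply/andP; split; apply/forall_inP => x; rewrite inE).
- have /negbTE-> : ~~ (c * j.+1 <= 0) by nia.
  apply/eqP; rewrite cards_eq0; apply/eqP/setP => J; rewrite !inE.
  apply/negP => /and3P[/eqP cardJ /forall_inP leJ _].
  have /card_gt0P[p /leJ] : 0 < #|J| by rewrite cardJ.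
  lia.
case: (ltnP b.+1 c) => [lt_bc|le_cb].
  have /negbTE-> : ~~ (c * j.+1 <= b.+1) by nia.
  apply/eqP; rewrite cards_eq0; apply/eqP/setP => J; rewrite !inE.
  apply/negP => /and3P[/eqP cardJ /forall_inP leJ _].
  have /card_gt0P[p /leJ] : 0 < #|J| by rewrite cardJ.
  lia.
have lt_pm : b.+1 - c < m by lia.
pose p := Ordinal lt_pm.
rewrite -(cardsID [set J : {set 'I_m} | p \in J]) addnC.
pose S b' j' := [set J : {set 'I_m} | [&& #|J| == j',
       [forall p in J, p + c <= b'] &
       [forall p in J, forall q in J, (p < q) ==> (p + c <= q)]]].
transitivity (#|S b j.+1| + #|S (b.+1 - c) j|).
  congr (_ + _).
    apply: eq_card => J; rewrite !inE.
    apply/andP/and3P => [[pJ /and3P[cardJ leJ sepJ]]|[cardJ leJ sepJ]].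
      split=> //; apply/forall_inP => q qJ.
      have := forall_inP leJ q qJ; rewrite leq_eqVlt => /orP[/eqP eq_q|//].
      by case/negP: pJ; rewrite (_ : p = q) //; apply: val_inj; rewrite /=; lia.
    split; last first.
      apply/and3P; split=> //; apply/forall_inP => q /(forall_inP leJ); lia.
    by apply/negP => /(forall_inP leJ) /=; lia.
  rewrite -[RHS](card_in_imset (f := fun J : {set 'I_m} => p |: J)); last first.
    have notin J : J \in S (b.+1 - c) j -> p \notin J.
      rewrite inE => /and3P[_ leJ _].
      by apply/negP => /(forall_inP leJ) /=; lia.
    move=> J1 J2 /notin pJ1 /notin pJ2 eqJ.
    by rewrite -(setU1K pJ1) -(setU1K pJ2) eqJ.
  apply: eq_card => J; apply/idP/imsetP.
    rewrite !inE => /andP[/and3P[/eqP cardJ leJ sepJ] pJ].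
    exists (J :\ p); last by rewrite setD1K.
    rewrite inE; apply/and3P; split.
    - by move: cardJ; rewrite (cardsD1 p) pJ add1n => -[->].
    - apply/forall_inP => q; rewrite !inE => /andP[neq_qp qJ].
      have := forall_inP leJ q qJ.
      have := forall_inP (forall_inP sepJ q qJ) p pJ.
      have : q != p :> nat by [].
      rewrite /=; lia.
    - apply/forall_inP => q; rewrite !inE => /andP[_ qJ].
      apply/forall_inP => r; rewrite !inE => /andP[_ rJ].
      exact: forall_inP (forall_inP sepJ q qJ) r rJ.
  case=> J'; rewrite inE => /and3P[/eqP cardJ leJ sepJ] ->.
  have pJ' : p \notin J' by apply/negP => /(forall_inP leJ) /=; lia.
  rewrite !inE eqxx cardsU1 pJ' cardJ eqxx andbT /=; apply/andP; split.
    apply/forall_inP => q; rewrite !inE => /orP[/eqP->|/(forall_inP leJ)] /=;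
      lia.
  apply/forall_inP => q; rewrite !inE => qJ.
  apply/forall_inP => r; rewrite !inE => rJ.
  case/orP: qJ rJ => [/eqP->|qJ] /orP[/eqP->|rJ].
  - by rewrite ltnn.
  - by have := forall_inP leJ r rJ; rewrite /=; lia.
  - by have := forall_inP leJ q qJ; rewrite /=; lia.
  - exact: forall_inP (forall_inP sepJ q qJ) r rJ.
rewrite /S (IHb b _ j.+1 (ltnW le_bm)) // IHb; try lia.
rewrite mulnS; case: (leqP (c + c * j) b.+1) => [le_cjb|lt_bcj]; last first.
  have /negbTE-> : ~~ (c + c * j <= b) by lia.
  by have /negbTE-> : ~~ (c * j <= b.+1 - c) by lia.
have -> : c * j <= b.+1 - c by lia.
have -> : b.+1 - c - c * j + j = b.+1 - (c + c * j) + j by lia.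
case: (leqP (c + c * j) b) => [le_cj|lt_cj].
  have -> : b.+1 - (c + c * j) + j.+1 = (b - (c + c * j) + j.+1).+1 by lia.
  have -> : b.+1 - (c + c * j) + j = b - (c + c * j) + j.+1 by lia.
  by rewrite binS addnC.
(* The hits fill the whole range: the sets avoiding [p] contribute 0, and both binomials are 1. *)
have -> : b.+1 - (c + c * j) = 0 by lia.
by rewrite !binn.
Qed.

(** * Refilling a hit *)

Section Blocks.

Variables (n c : nat).
Hypotheses (c_gt0 : 0 < c) (le_cn : c <= n).
Implicit Types (w : 'S_n) (p q : 'I_(n - c).+1) (s u : 'S_c) (x y : 'I_n).

Lemma block_pos_subproof p (i : 'I_c) : p + i < n.
Proof. by have := ltn_ord p; have := ltn_ord i; lia. Qed.

Definition block_pos p (i : 'I_c) : 'I_n := Ordinal (block_pos_subproof p i).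

Lemma block_posP p x : reflect (exists i, x = block_pos p i) (p <= x < p + c).
Proof.
apply: (iffP idP) => [in_p|[i ->]]; last by have := ltn_ord i; rewrite /=; lia.
have lt_xpc : x - p < c by lia.
by exists (Ordinal lt_xpc); apply: val_inj; rewrite /=; lia.
Qed.

(** The test [p <= x] excludes the positions before [p], which truncated subtraction would all send
    to 0. *)
Definition block_fun p s x : 'I_n :=
  if (if p <= x then insub (x - p) else None) is Some i
  then block_pos p (s i) else x.

Lemma block_fun_in p s i : block_fun p s (block_pos p i) = block_pos p (s i).
Proof.
by rewrite /block_fun leq_addr /= addKn insubT //= => lt_ic;
  congr (block_pos p (s _)); apply: val_inj.
Qed.

Lemma block_fun_out p s x : ~~ (p <= x < p + c) -> block_fun p s x = x.
Proof.
rewrite /block_fun; case: (leqP p x) => //= le_px out.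
by rewrite insubF //=; apply: negbTE; rewrite -leqNgt; lia.
Qed.

Lemma block_funK p s : cancel (block_fun p s) (block_fun p s^-1).
Proof.
move=> x; case: (boolP (p <= x < p + c)) => [/block_posP[i ->]|out].
  by rewrite !block_fun_in permK.
by rewrite !block_fun_out.
Qed.

Definition block_perm p s : 'S_n := perm (can_inj (@block_funK p s)).

(** Permuting positions by a left multiplication makes this a bijection of ['S_n] for fixed [p] and
    [s], whether or not there is a hit at [p]. *)
Definition refill p s w : 'S_n := (block_perm p s * w)%g.

Lemma refill_in p s w i : refill p s w (block_pos p i) = w (block_pos p (s i)).
Proof. by rewrite permM permE block_fun_in. Qed.

Lemma refill_out p s w x : ~~ (p <= x < p + c) -> refill p s w x = w x.
Proof. by move=> out; rewrite permM permE block_fun_out. Qed.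

Lemma refill_inj p s : injective (refill p s).
Proof. exact: mulgI. Qed.

Lemma refillK p s : cancel (refill p s) (refill p s^-1).
Proof.
move=> w; apply/permP => x.
case: (boolP (p <= x < p + c)) => [/block_posP[i ->]|out].
  by rewrite !refill_in permKV.
by rewrite !refill_out.
Qed.

Lemma at_posE w p : at_pos w p = [seq val (w (block_pos p i)) | i <- enum 'I_c].
Proof.
have size_at : size (at_pos w p) = c.
  rewrite size_takel // size_drop size_word.
  by have := ltn_ord p; lia.
apply: (@eq_from_nth _ 0) => [|i].
  by rewrite size_at size_map size_enum_ord.
rewrite size_at => lt_ic.
rewrite nth_take // nth_drop (nth_map (Ordinal lt_ic)) ?size_enum_ord //.
have -> : nth (Ordinal lt_ic) (enum 'I_c) i = Ordinal lt_ic.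
  exact: nth_ord_enum (Ordinal lt_ic).
exact: nth_word w (block_pos p (Ordinal lt_ic)).
Qed.

Lemma forms_at w p u :
  reflect (exists k, forall i, w (block_pos p i) = u i + k :> nat)
          (forms (at_pos w p) u).
Proof.
have size_at : size (at_pos w p) = c by rewrite at_posE size_map size_enum_ord.
have nth_at (i : 'I_c) : nth 0 (at_pos w p) i = w (block_pos p i).
  by rewrite at_posE (nth_map i) ?size_enum_ord // nth_ord_enum.
apply: (iffP (formsP _ _ c_gt0)) => [[k [_ eqk]]|[k eqk]]; last first.
  by exists (Posz k); split=> // i; rewrite nth_at eqk PoszD.
(* At [i0] the value of [u] is 0, so [k] is a letter of [w] and therefore nonnegative. *)
pose i0 := (u^-1)%g (Ordinal c_gt0).
have k_ge0 : (0 <= k)%R.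
  by have := eqk i0; rewrite permKV /=; lia.
exists `|k|%N => i; have := eqk i; rewrite nth_at; lia.
Qed.

Lemma forms_at_inj w p u u' :
  forms (at_pos w p) u -> forms (at_pos w p) u' -> u = u'.
Proof.
move=> /forms_at[k eqk] /forms_at[k' eqk'].
have eq_uu' i : u i + k = u' i + k' by rewrite -eqk eqk'.
(* Comparing where [u] and [u'] vanish gives both inequalities between the shifts. *)
have := eq_uu' (u^-1 (Ordinal c_gt0))%g.
have := eq_uu' (u'^-1 (Ordinal c_gt0))%g.
rewrite !permKV /= => le1 le2.
by apply/permP => i; apply/val_inj => /=; have := eq_uu' i; lia.
Qed.

Lemma forms_refill p s w u :
  forms (at_pos w p) u -> forms (at_pos (refill p s w) p) (s * u)%g.
Proof.
move=> /forms_at[k eqk]; apply/forms_at; exists k => i.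
by rewrite refill_in eqk permM.
Qed.

(** When [P] partitions all of ['S_c], these are the [P]-hits; see [P_hitE]. *)
Definition hit w p := [exists u : 'S_c, forms (at_pos w p) u].

Lemma hit_refill p s w : hit (refill p s w) p = hit w p.
Proof.
apply/existsP/existsP => -[u]; last by move=> /forms_refill; exists (s * u)%g.
by move/(forms_refill s^-1); rewrite refillK; exists (s^-1 * u)%g.
Qed.

Lemma at_pos_refill_disjoint p q s w :
  ~~ overlap p q -> at_pos (refill p s w) q = at_pos w q.
Proof.
move=> disj; rewrite !at_posE; apply: eq_map => i; rewrite refill_out //.
apply: contra disj => in_p; apply/existsP; exists (block_pos q i).
by rewrite in_p; apply/block_posP; exists i.
Qed.

Lemma overlapE p q : overlap p q = (p < q + c) && (q < p + c).
Proof.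
apply/existsP/idP => [[i]|]; first by lia.
move=> /andP[lt1 lt2]; have lt_max : maxn p q < n.
  by have := ltn_ord p; have := ltn_ord q; lia.
by exists (Ordinal lt_max) => /=; lia.
Qed.

Definition same_outside p w w' :=
  [&& take p (word w') == take p (word w),
      drop (p + c) (word w') == drop (p + c) (word w) &
      perm_eq (at_pos w' p) (at_pos w p)].

Lemma same_outside_refill p s w : same_outside p w (refill p s w).
Proof.
have outE i : ~~ (p <= i < p + c) ->
    nth 0 (word (refill p s w)) i = nth 0 (word w) i.
  move=> out; case: (ltnP i n) => [lt_in|le_ni].
    by rewrite !(nth_word _ (Ordinal lt_in)) refill_out.
  by rewrite !nth_default ?size_word.
apply/and3P; split.
- apply/eqP/(@eq_from_nth _ 0); rewrite !size_take !size_word // => i lti.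
  have lt_ip : i < p by move: lti; case: ifP => //; lia.
  by rewrite !nth_take // outE //; lia.
- apply/eqP/(@eq_from_nth _ 0); rewrite !size_drop !size_word // => i _.
  by rewrite !nth_drop outE //; lia.
rewrite !at_posE.
rewrite (eq_map (g := (fun i => val (w (block_pos p i))) \o s)); last first.
  by move=> i /=; rewrite refill_in.
rewrite map_comp; apply/perm_map/uniq_perm; rewrite ?enum_uniq //.
  by rewrite (map_inj_uniq perm_inj) enum_uniq.
move=> i; rewrite mem_enum; apply/mapP; exists (s^-1 i)%g; rewrite ?mem_enum //.
by rewrite permKV.
Qed.

(** The contracted word sees the hit only through its average, which depends on the letters and not
    on their order. So a hit keeps its own polarization when refilled. *)
Lemma contract_same_outside p w w' :
  same_outside p w w' -> contract w' p = contract w p.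
Proof.
case/and3P=> /eqP eq_take /eqP eq_drop eq_at.
rewrite /contract eq_take eq_drop; congr (_ ++ _ :: _).
by rewrite /average (perm_big _ eq_at) /= (perm_size eq_at).
Qed.

Lemma right_polarized_same_outside p w w' :
  same_outside p w w' -> right_polarized w' p = right_polarized w p.
Proof.
by move=> so;
  rewrite /right_polarized /closest_is_left (contract_same_outside so).
Qed.

(** The letters of the hit exhaust an interval of length [c], so by injectivity no other position
    carries a letter from it. *)
Lemma hit_interval w p : hit w p ->
  exists k, forall x, (k <= w x < k + c) = (p <= x < p + c).
Proof.
case/existsP=> u /forms_at[k eqk]; exists k => x; apply/idP/block_posP.
  move=> in_k; have lt_wx : w x - k < c by lia.
  exists (u^-1 (Ordinal lt_wx))%g; apply: (@perm_inj _ w); apply: val_inj => /=.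
  by rewrite eqk permKV /=; lia.
by case=> i ->; rewrite eqk; have := ltn_ord (u i); lia.
Qed.

Local Notation letter w i := (nth 0 (word w) i).

(** A letter outside the hit lies on the same side of all its letters, so only comparisons between
    two positions of the hit can change. *)
Lemma refill_lt w p s i j : hit w p -> i < n -> j < n ->
    ~~ ((p <= i < p + c) && (p <= j < p + c)) ->
  (letter (refill p s w) i < letter (refill p s w) j)
    = (letter w i < letter w j).
Proof.
move=> /hit_interval[k in_k] lt_in lt_jn.
rewrite !(nth_word _ (Ordinal lt_in)) !(nth_word _ (Ordinal lt_jn)).
set x := Ordinal lt_in; set y := Ordinal lt_jn.
rewrite -[i]/(val x) -[j]/(val y).
have in_kw (z : 'I_n) : p <= z < p + c -> k <= refill p s w z < k + c.
  by case/block_posP=> l ->; rewrite refill_in in_k; apply/block_posP;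
    exists (s l).
have := in_k x; have := in_k y.
case: (boolP (p <= x < p + c)) => in_x;
  case: (boolP (p <= y < p + c)) => in_y //.
- by rewrite [refill _ _ _ y]refill_out //; have := in_kw x in_x; lia.
- by rewrite [refill _ _ _ x]refill_out //; have := in_kw y in_y; lia.
- by rewrite !refill_out.
Qed.

(** * Polarization as a cyclic order *)

Definition cyclic3 (a b d : nat) := [|| a < b < d, d < a < b | b < d < a].

(** The first letter of the hit stands for its average; the two ends of the word are treated apart,
    one neighbour being absent there. *)
Definition cyclic_polarized w p :=
  (c != n) && if p == 0 :> nat then letter w p < letter w (p + c)
  else if p + c == n then letter w p.-1 < letter w p
  else cyclic3 (letter w p.-1) (letter w p) (letter w (p + c)).

(** At most one of the positions compared lies in the hit at [p]: a block of consecutive positions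
    containing both neighbours of the hit at [q] would overlap it. Hence [refill_lt] applies. *)
Lemma cyclic_polarized_refill p q s w : hit w p -> ~~ overlap p q ->
  cyclic_polarized (refill p s w) q = cyclic_polarized w q.
Proof.
rewrite overlapE => hit_p disj; have lt_q := ltn_ord q; have lt_p := ltn_ord p.
rewrite /cyclic_polarized /cyclic3; case: eqVneq => //= neq_cn.
case: eqVneq => [q0|q0]; first by rewrite refill_lt //; lia.
case: eqVneq => [qn|qn]; first by rewrite refill_lt //; lia.
by rewrite !refill_lt //; lia.
Qed.

Local Open Scope ring_scope.

Lemma average_between w p k :
  (forall i, (k <= w (block_pos p i) < k + c)%N) ->
  k%:R <= average (at_pos w p) < (k + c)%:R.
Proof.
move=> in_k.
rewrite /average at_posE size_map size_enum_ord big_map big_enum /=.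
have c_pos : 0 < c%:R :> rat by rewrite ltr0n.
rewrite ler_pdivlMr // ltr_pdivrMr //.
have constE a : a%:R * c%:R = \sum_(i < c) a%:R :> rat.
  by rewrite sumr_const card_ord mulr_natr.
rewrite !constE; apply/andP; split.
  by apply: ler_sum => i _; rewrite ler_nat; case/andP: (in_k i).
apply: ltr_sum => [|i _]; last by rewrite ltr_nat; case/andP: (in_k i).
by apply/hasP; exists (Ordinal c_gt0); rewrite ?mem_index_enum.
Qed.

(** The average and the first letter lie in the interval [k, k + c) spanned by the hit, which
    contains no outside letter; so they are interchangeable in comparisons. *)
Lemma average_cmp w p i : hit w p -> (i < n)%N -> ~~ (p <= i < p + c)%N ->
  let a := average (at_pos w p) in let l := (letter w i)%:R in
  ((l < a) = (letter w i < letter w p)%N) *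
  ((a < l) = (letter w p < letter w i)%N) * (l != a).
Proof.
move=> /hit_interval[k in_k] lt_in out /=.
have lt_pn : (p < n)%N by have := ltn_ord p; lia.
have /andP[le_ka lt_ak] : k%:R <= average (at_pos w p) < (k + c)%:R.
  by apply: average_between => l; rewrite in_k; apply/block_posP; exists l.
rewrite !(nth_word _ (Ordinal lt_in)) !(nth_word _ (Ordinal lt_pn)).
have := in_k (Ordinal lt_pn); have := in_k (Ordinal lt_in) => /=.
rewrite (negbTE out) (_ : (p <= p < p + c)%N = true); last by lia.
move: (w (Ordinal lt_in)) (w (Ordinal lt_pn)) => x y /negbT out_x in_y.
case: (ltnP x k) => [lt_xk|le_kx].
  have lt_xa : x%:R < average (at_pos w p).
    by rewrite (lt_le_trans _ le_ka) // ltr_nat.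
  rewrite lt_xa (lt_gtF lt_xa) (lt_eqF lt_xa).
  have -> : (x < y)%N by lia.
  by have -> : (y < x)%N = false by lia.
have lt_ax : average (at_pos w p) < x%:R.
  by rewrite (lt_le_trans lt_ak) // ler_nat; lia.
rewrite lt_ax (lt_gtF lt_ax) (gt_eqF lt_ax).
have -> : (x < y)%N = false by lia.
by have -> : (y < x)%N by lia.
Qed.

Lemma nth_contract w p : nth 0 (contract w p) p = average (at_pos w p).
Proof.
have lt_p := ltn_ord p.
rewrite /contract nth_cat size_map size_take size_word.
by rewrite (_ : p < n)%N ?ltnn ?subnn //; lia.
Qed.

Lemma nth_contract_pred w p : (0 < p)%N ->
  nth 0 (contract w p) p.-1 = (letter w p.-1)%:R.
Proof.
move=> p_gt0; have lt_p := ltn_ord p.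
rewrite /contract nth_cat size_map size_take size_word.
rewrite (_ : p < n)%N; last by lia.
rewrite prednK // leqnn (nth_map 0%N) ?nth_take ?prednK //.
by rewrite size_take size_word (_ : p < n)%N ?prednK //; lia.
Qed.

Lemma nth_contract_succ w p : (p + c < n)%N ->
  nth 0 (contract w p) p.+1 = (letter w (p + c))%:R.
Proof.
move=> lt_pcn; rewrite /contract nth_cat size_map size_take size_word.
rewrite (_ : p < n)%N; last by lia.
rewrite ltnNge leqnSn /= subSnn /= (nth_map 0%N) ?nth_drop ?addn0 //.
by rewrite size_drop size_word; lia.
Qed.

Lemma right_polarizedE w p :
  hit w p -> right_polarized w p = cyclic_polarized w p.
Proof.
move=> hit_p; have lt_p := ltn_ord p.
rewrite /right_polarized /closest_is_left /cyclic_polarized nth_contract.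
case: eqVneq => //= neq_cn; rewrite lt0n.
case: eqVneq => [p0|p_neq0] /=.
  rewrite nth_contract_succ ?average_cmp //; try lia.
rewrite nth_contract_pred; last by lia.
case: eqVneq => [pcn|neq_pcn] /=; first by rewrite average_cmp //; lia.
have lt_l : (p.-1 < n)%N by lia.
have lt_r : (p + c < n)%N by lia.
have out_l : ~~ (p <= p.-1 < p + c)%N by lia.
have out_r : ~~ (p <= p + c < p + c)%N by lia.
have [[la _] neq_la] := average_cmp hit_p lt_l out_l.
have [[_ ar] neq_ra] := average_cmp hit_p lt_r out_r.
rewrite nth_contract_succ // closest_cyclic //; last first.
  by rewrite eqr_nat nth_uniq ?size_word ?word_uniq //; lia.
by rewrite la ar !ltr_nat.
Qed.

(** The average never equals a neighbouring letter, so the two strict comparisons are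
    complementary. *)
Lemma left_polarizedE w p :
  hit w p -> left_polarized w p = ~~ right_polarized w p.
Proof.
move=> hit_p; have lt_p := ltn_ord p.
rewrite /left_polarized /right_polarized nth_contract.
case: eqVneq => //= neq_cn.
case: ifP; rewrite /closest_is_left => close.
  rewrite nth_contract_pred; last by lia.
  have lt_l : (p.-1 < n)%N by lia.
  have out_l : ~~ (p <= p.-1 < p + c)%N by lia.
  have [_ neq_la] := average_cmp hit_p lt_l out_l.
  by rewrite lt_neqAle leNgt eq_sym neq_la.
have lt_r : (p + c < n)%N by lia.
rewrite nth_contract_succ //.
have out_r : ~~ (p <= p + c < p + c)%N by lia.
have [_ neq_ra] := average_cmp hit_p lt_r out_r.
by rewrite lt_neqAle leNgt neq_ra.
Qed.

Local Close Scope ring_scope.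

Lemma right_polarized_refill p q s w : hit w p -> hit w q -> ~~ overlap p q ->
  right_polarized (refill p s w) q = right_polarized w q.
Proof.
move=> hit_p hit_q disj; have hit_q' : hit (refill p s w) q.
  by rewrite /hit at_pos_refill_disjoint.
by rewrite !right_polarizedE // cyclic_polarized_refill.
Qed.

(** With [b] the right polarization of a hit, this is the leaning that makes it forward; see
    [forwardE]. *)
Definition lean (b : bool) v := if b then right_leaning v else left_leaning v.

Lemma at_pos_forms w p u : forms (at_pos w p) u ->
  exists k, at_pos w p = [seq y + k | y : nat <- word u].
Proof. by case/existsP => k /eqP ->; exists k. Qed.

Lemma lean_forms b w p u : forms (at_pos w p) u ->
  lean b (at_pos w p) = lean b (word u).
Proof.
case/at_pos_forms=> k ->.
by rewrite /lean right_leaning_addn left_leaning_addn.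
Qed.

(** A hit that is not backward leans to some side, and by [leaning_exclusive] to one only, which
    must be the side of its polarization. *)
Lemma forwardE w p u : forms (at_pos w p) u ->
  forward w p = lean (right_polarized w p) (word u).
Proof.
move=> forms_u; have hit_p : hit w p by apply/existsP; exists u.
rewrite /forward /backward /omni_leaning left_polarizedE //.
rewrite -!(lean_forms _ forms_u) /lean.
have := @leaning_exclusive (at_pos w p).
have -> : uniq (at_pos w p).
  by rewrite /at_pos /subword take_uniq // drop_uniq // word_uniq.
move/(_ isT); case: right_polarized; case: right_leaning;
  case: left_leaning => //=.
all: by move/(_ isT).
Qed.

(** * Words with prescribed hits *)

Definition hits_at (J : {set 'I_(n - c).+1}) : {set 'S_n} :=
  [set w | [forall p in J, hit w p]].

Definition spread (J : {set 'I_(n - c).+1}) : bool :=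
  [forall p in J, forall q in J, (p < q) ==> (p + c <= q)].

Lemma spread_overlap J p q : spread J -> p \in J -> q \in J -> p != q ->
  ~~ overlap p q.
Proof.
move=> spJ pJ qJ neq_pq; rewrite overlapE.
have := forall_inP (forall_inP spJ p pJ) q qJ.
have := forall_inP (forall_inP spJ q qJ) p pJ.
have : p != q :> nat by [].
lia.
Qed.

Lemma hits_at_refill J p s w : spread J -> p \in J ->
  (refill p s w \in hits_at J) = (w \in hits_at J).
Proof.
move=> spJ pJ; rewrite !inE; apply: eq_forallb => q.
case: (boolP (q \in J)) => //= qJ; case: (eqVneq p q) => [<-|neq_pq].
  exact: hit_refill.
by rewrite /hit at_pos_refill_disjoint // (spread_overlap spJ).
Qed.

(* Double counting of the pairs (s, w) such that [refill p s w] satisfies [Q p],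
   for one position p of J after the other. *)
Lemma card_refill J (Q : 'I_(n - c).+1 -> pred 'S_n) m : spread J ->
    (forall p q s w, p \in J -> q \in J -> p != q -> w \in hits_at J ->
       Q q (refill p s w) = Q q w) ->
    (forall p w, p \in J -> w \in hits_at J ->
       #|[set s | Q p (refill p s w)]| = m) ->
  c`! ^ #|J| * #|[set w in hits_at J | [forall p in J, Q p w]]|
    = m ^ #|J| * #|hits_at J|.
Proof.
move=> spJ Q_refill card_Q.
(* For the induction, [Q] is imposed only on [K], while the hits remain prescribed on all of [J]. *)
suff card_K (K : {set 'I_(n - c).+1}) : K \subset J ->
    c`! ^ #|K| * #|[set w in hits_at J | [forall p in K, Q p w]]|
      = m ^ #|K| * #|hits_at J|.
  exact: card_K.
have [k] := ubnP #|K|; elim: k K => // k IHk K lt_Kk sKJ.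
have [->|[p pK]] := set_0Vmem K.
  rewrite cards0 !expn0 !mul1n; apply: eq_card => w; rewrite !inE.
  rewrite (_ : [forall p in set0, _]) ?andbT //.
  by apply/forall_inP => p; rewrite inE.
have pJ := subsetP sKJ p pK.
have cardK := cardsD1 p K; rewrite pK add1n in cardK.
set Y := [set w in _ | _].
pose X := [set w in hits_at J | [forall q in K :\ p, Q q w]].
have IH : c`! ^ #|K :\ p| * #|X| = m ^ #|K :\ p| * #|hits_at J|.
  apply: IHk; first by rewrite -ltnS -cardK.
  exact: subset_trans (subsetDl _ _) sKJ.
suff cardY : c`! * #|Y| = m * #|X|.
  by rewrite cardK !expnSr -!mulnA cardY mulnCA IH; ring.
(* Reindex along the bijection [refill p s]: it preserves the hits and the conditions at the other
   positions of [K]. *)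
have Y_refill s : \sum_(w in X) (Q p (refill p s w) : nat) = #|Y|.
  rewrite -(card_preimset Y (@refill_inj p s)) -sum1_card.
  rewrite big_mkcond [RHS]big_mkcond /=.
  apply: eq_bigr => w _; rewrite [w \in _ @^-1: _]inE [in RHS]inE [w \in X]inE.
  rewrite hits_at_refill //; case: (boolP (w \in hits_at J)) => //= w_J.
  rewrite -(setD1K pK).
  have -> : [forall q in p |: K :\ p, Q q (refill p s w)]
     = Q p (refill p s w) && [forall q in K :\ p, Q q w].
    have QE q : q \in K :\ p -> Q q (refill p s w) = Q q w.
      rewrite !inE => /andP[neq_qp qK]; apply: Q_refill => //;
        last by rewrite eq_sym.
      exact: (subsetP sKJ).
    apply/forall_inP/andP => [all_Q|[Qp /forall_inP all_Q] q].
      split; first by rewrite all_Q // setU11.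
      by apply/forall_inP => q qK; rewrite -QE // all_Q // setU1r.
    by case/setU1P=> [-> //|qK]; rewrite QE // all_Q.
  by rewrite (setD1K pK); case: [forall q in _, _]; case: (Q p _).
have cardS : \sum_(s : 'S_c) #|Y| = c`! * #|Y| by rewrite sum_nat_const card_Sn.
rewrite -cardS; under eq_bigr => s _ do rewrite -(Y_refill s).
rewrite exchange_big /= mulnC -sum_nat_const; apply: eq_bigr => w wX.
rewrite -(card_Q p w) //; last by move: wX; rewrite inE => /andP[].
by rewrite -sum1dep_card [RHS]big_mkcond; apply: eq_bigr => s _; case: (Q p _).
Qed.

Lemma forms1P w p :
  reflect (forall i, p <= i < p + c.-1 -> letter w i.+1 = (letter w i).+1)
          (forms (at_pos w p) (1%g : 'S_c)).
Proof.
have lt_p := ltn_ord p.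
have letter_block (i : 'I_c) : letter w (p + i) = w (block_pos p i).
  exact: nth_word w (block_pos p i).
apply: (iffP (forms_at _ _ _)) => [[k eqk] i in_p|succ].
  have lt1 : i - p < c by lia.
  have lt2 : (i - p).+1 < c by lia.
  have := eqk (Ordinal lt1); have := eqk (Ordinal lt2);
    rewrite !perm1 -!letter_block /=.
  have -> : p + (i - p).+1 = i.+1 by lia.
  have -> : p + (i - p) = i by lia.
  lia.
exists (letter w p) => -[i lt_ic]; rewrite perm1 -letter_block /=.
elim: i lt_ic => [|i IHi] lt_ic; first by rewrite addn0.
by rewrite addnS succ ?IHi; lia.
Qed.

Lemma card_hits_at J : spread J ->
  #|hits_at J| = c`! ^ #|J| * (n - c.-1 * #|J|)`!.
Proof.
move=> spJ; pose Q p w := forms (at_pos w p) (1%g : 'S_c).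
have Q_refill p q s w : p \in J -> q \in J -> p != q -> w \in hits_at J ->
    Q q (refill p s w) = Q q w.
  by move=> pJ qJ neq_pq _;
    rewrite /Q at_pos_refill_disjoint // (spread_overlap spJ).
have card_Q p w : p \in J -> w \in hits_at J ->
  #|[set s | Q p (refill p s w)]| = 1.
  rewrite inE => pJ /forall_inP /(_ p pJ) /existsP[u forms_u].
  (* Refilling by [s] turns [u] into [s * u], so exactly one [s] yields the identity. *)
  apply/eqP/cards1P; exists (u^-1)%g; apply/setP => s; rewrite !inE.
  apply/idP/eqP => [Qs|->]; last first.
    by have := forms_refill u^-1 forms_u; rewrite mulVg.
  have /eqP := forms_at_inj (forms_refill s forms_u) Qs.
  by rewrite mulg_eq1 => /eqP.
have := card_refill spJ Q_refill card_Q; rewrite exp1n mul1n => <-;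
  congr (_ * _).
(* The last position of a hit is left out: it starts no prescribed succession. *)
pose B (p : 'I_(n - c).+1) := [set x : 'I_n | p <= x < p + c.-1].
have cardB p : #|B p| = c.-1.
  have le_c : c.-1 <= c by lia.
  have inj_f : injective (fun i : 'I_c.-1 => block_pos p (widen_ord le_c i)).
    by move=> i j /(congr1 val) /= /addnI /val_inj.
  rewrite -[RHS]card_ord -(card_imset _ inj_f).
  apply: eq_card => x; rewrite inE.
  apply/idP/imsetP => [in_p|[i _ ->]]; last first.
    by have := ltn_ord i; rewrite /=; lia.
  have lt_xp : x - p < c.-1 by lia.
  by exists (Ordinal lt_xp) => //; apply: val_inj; rewrite /=; lia.
pose U := [set x : 'I_n | [exists p in J, x \in B p]].
have cardU : #|U| = c.-1 * #|J|.
  transitivity (\sum_x \sum_(p in J) (x \in B p : nat)).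
    rewrite -sum1_card big_mkcond; apply: eq_bigr => x _ /=; rewrite inE.
    case: (boolP [exists p in J, _]) => [/exists_inP[p pJ xp]|/exists_inPn xJ];
      last first.
      by rewrite big1 // => p /xJ /negbTE->.
    rewrite (bigD1 p) //= xp big1 // => q /andP[qJ neq_qp].
    have := spread_overlap spJ qJ pJ neq_qp; rewrite overlapE.
    by move: xp; rewrite !inE; lia.
  rewrite exchange_big /= mulnC -sum_nat_const; apply: eq_bigr => p _.
  by rewrite -(cardB p) -sum1_card [RHS]big_mkcond.
have sorted_U : sorted gtn (rev [seq val x | x <- enum U]).
  rewrite rev_sorted sorted_map /enum_mem sorted_filter; first by [].
    by move=> x y z; exact: ltn_trans.
  have := iota_ltn_sorted 0 n; rewrite -val_enum_ord sorted_map.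
  by rewrite enumT.
have lt_U : all (fun i => i.+1 < n) (rev [seq val x | x <- enum U]).
  rewrite all_rev; apply/allP => _ /mapP[x + ->].
  rewrite mem_enum inE => /exists_inP[p _]; rewrite inE /=.
  by have := ltn_ord p; lia.
have := card_successions sorted_U lt_U.
rewrite size_rev size_map -cardE cardU => <-.
apply: eq_card => w; rewrite !inE all_rev all_map;
  apply/andP/allP => [[_ /forall_inP succ] x|succ].
  rewrite mem_enum inE => /exists_inP[p pJ]; rewrite inE => xp.
  by apply/eqP; apply: (elimT (forms1P w p) (succ p pJ)).
have Q_J : [forall p in J, Q p w].
  apply/forall_inP => p pJ; apply/forms1P => i in_p.
  have lt_in : i < n by have := ltn_ord p; lia.
  apply/eqP; apply: (succ (Ordinal lt_in)).
  by rewrite mem_enum inE; apply/exists_inP; exists p => //; rewrite inE.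
split=> //; apply/forall_inP => p /(forall_inP Q_J) Qp.
by apply/existsP; exists 1%g.
Qed.

(** * Straightening *)

Section Straightening.

Variables (P : {set {set 'S_c}}) (C : {set 'S_c}).
Hypotheses (partP : partition P [set: 'S_c]) (strC : straightening_set P C).

Lemma mem_pblockT u : u \in pblock P u.
Proof. by rewrite mem_pblock (cover_partition partP) inE. Qed.

Lemma pblockT_mem u : pblock P u \in P.
Proof. by rewrite pblock_mem // (cover_partition partP) inE. Qed.

Lemma P_hitE w p : P_hit P w p = hit w p.
Proof.
apply/exists_inP/existsP => [[B BP /exists_inP[u _]]|[u forms_u]];
  first by exists u.
exists (pblock P u); first exact: pblockT_mem.
by apply/exists_inP; exists u; rewrite ?mem_pblockT.
Qed.

Lemma P_rearr_atE w w' p u u' :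
    forms (at_pos w p) u -> forms (at_pos w' p) u' ->
  P_rearr_at P p w w' = same_outside p w w' && (u' \in pblock P u).
Proof.
move=> forms_u forms_u'; rewrite /P_rearr_at /same_outside -!andbA;
  do 3 congr (_ && _).
apply/exists_inP/idP =>
  [[B BP /andP[/exists_inP[v vB fv] /exists_inP[v' vB' fv']]]|in_u].
  rewrite (forms_at_inj forms_u fv) (forms_at_inj forms_u' fv').
  by rewrite (def_pblock (partition_trivIset partP) BP vB).
exists (pblock P u); first exact: pblockT_mem.
by apply/andP; split; apply/exists_inP;
  [exists u; rewrite ?mem_pblockT | exists u'].
Qed.

Lemma P_rearr_at_forms w w' p : P_rearr_at P p w w' ->
  exists u u', forms (at_pos w p) u /\ forms (at_pos w' p) u'.
Proof.
case/and4P=> _ _ _ /exists_inP[B _].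
by case/andP=> /exists_inP[u _ fu] /exists_inP[u' _ fu']; exists u, u'.
Qed.

Lemma P_rearr_at_refill w p u u' : forms (at_pos w p) u -> u' \in pblock P u ->
  P_rearr_at P p w (refill p (u' * u^-1) w).
Proof.
move=> forms_u in_u; have := forms_refill (u' * u^-1)%g forms_u.
rewrite mulgKV => forms_u'.
by rewrite (P_rearr_atE forms_u forms_u') same_outside_refill.
Qed.

(** Straightenedness read off the formed permutation, given the polarization [b] of the hit. *)
Definition good b u := (u \in C) &&
  (lean b (word u) || ~~ [exists u' in pblock P u, lean b (word u')]).

(** Rearranging a hit keeps its polarization, so whether it can be made forward depends only on the
    part of [u] and on that polarization. *)
Lemma straightenedE w p u : forms (at_pos w p) u ->
  straightened P C w p = good (right_polarized w p) u.
Proof.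
move=> forms_u; have hit_p : hit w p by apply/existsP; exists u.
rewrite /straightened P_hitE hit_p /good /=; congr (_ && _).
  apply/exists_inP/idP => [[v vC fv]|uC]; last by exists u.
  by rewrite (forms_at_inj forms_u fv).
rewrite -(forwardE forms_u) -[backward w p]negbK -/(forward w p).
have -> : [exists w', P_rearr_at P p w w' && forward w' p]
   = [exists u' in pblock P u, lean (right_polarized w p) (word u')].
  apply/existsP/exists_inP => [[w' /andP[rearr fwd]]|[u' in_u lean_u']].
    have [v [u' [_ fu']]] := P_rearr_at_forms rearr.
    move: rearr; rewrite (P_rearr_atE forms_u fu') => /andP[same in_u].
    exists u' => //; rewrite -(right_polarized_same_outside same).
    by rewrite -(forwardE fu').
  exists (refill p (u' * u^-1) w); rewrite P_rearr_at_refill //.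
  have := forms_refill (u' * u^-1)%g forms_u; rewrite mulgKV => fu'.
  rewrite (forwardE fu').
  by rewrite (right_polarized_same_outside (same_outside_refill _ _ _)).
by case: (forward w p).
Qed.

(** If some element of [B] leans to side [b], the good ones are the elements of [C] in [B] with that
    leaning. Otherwise all of [B :&: C] is good; its elements all lean to the other side, or are all
    omni leaning. In each case [straightening_set] grants exactly one. *)
Lemma card_good_part b B : B \in P -> #|[set u in B | good b u]| = 1.
Proof.
move=> BP; have [_ /(_ B BP)[left_C right_C omni_C]] := strC.
have blockB u : u \in B -> pblock P u = B.
  exact: def_pblock (partition_trivIset partP) BP.
case: (boolP [exists u in B, lean b (word u)]) => [lean_B|nlean_B].
  rewrite -[RHS]/(nat_of_bool true) -lean_B.
  have -> : [set u in B | good b u] = [set u in B :&: C | lean b (word u)].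
    apply/setP => u; rewrite !inE /good -andbA;
      case: (boolP (u \in B)) => //= uB.
    by rewrite blockB // lean_B orbF.
  by case: (b).
have -> : [set u in B | good b u] = B :&: C.
  apply/setP => u; rewrite !inE /good; case: (boolP (u \in B)) => //= uB.
  by rewrite blockB // nlean_B orbT andbT.
have nlean u : u \in B -> lean b (word u) = false.
  by move=> uB; apply: contraNF nlean_B => lean_u; apply/exists_inP; exists u.
case: (boolP [exists u in B, lean (~~ b) (word u)]) => [lean_B|nlean_B'].
  have [u0 u0B lean_u0] := exists_inP lean_B.
  have not_omni : [forall u in B, omni_leaning (word u)] = false.
    apply/negP => /forall_inP /(_ u0 u0B); move: lean_u0;
      rewrite /omni_leaning /lean.
    by case: (b) => /= ->; rewrite ?andbF.
  rewrite not_omni in omni_C.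
  have /eqP := omni_C; rewrite cards_eq0 => /eqP omni0.
  rewrite -[RHS]/(nat_of_bool true) -lean_B.
  have -> : B :&: C = [set u in B :&: C | lean (~~ b) (word u)].
    apply/setP => u; rewrite [RHS]inE.
    case: (boolP (u \in B :&: C)) => //= uBC.
    have uB : u \in B by case/setIP: uBC.
    have : omni_leaning (word u) = false.
      by have := in_set0 u; rewrite -omni0 inE uBC.
    rewrite /omni_leaning; have := nlean u uB; rewrite /lean.
    by case: (b) => /= ->; rewrite ?andbT /= => /negbFE.
  by case: (b).
have omni_B : [forall u in B, omni_leaning (word u)].
  apply/forall_inP => u uB; have := nlean u uB.
  have : ~~ lean (~~ b) (word u).
    by apply: contra nlean_B' => lean_u; apply/exists_inP; exists u.
  by rewrite /omni_leaning /lean; case: (b) => /= [/negbTE-> ->|/negbTE-> ->].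
rewrite -[RHS]/(nat_of_bool true) -omni_B -omni_C.
apply: eq_card => u; rewrite [RHS]inE;
  case: (boolP (u \in B :&: C)) => //= /setIP[uB _].
by rewrite (forall_inP omni_B).
Qed.

Lemma card_good b : #|[set u | good b u]| = #|P|.
Proof.
rewrite -sum1_card big_mkcond /=.
rewrite (eq_bigl (mem (cover P))) => [|u]; last first.
  by rewrite (cover_partition partP) !inE.
rewrite (big_trivIset _ (partition_trivIset partP)) /= -sum1_card.
apply: eq_bigr => B BP; rewrite -big_mkcondr sum1dep_card
  -[RHS](card_good_part b BP).
by apply: eq_card => u; rewrite !inE.
Qed.

Lemma card_not_good b : #|[set u | ~~ good b u]| = c`! - #|P|.
Proof.
rewrite -(card_good b) -card_Sn [LHS]cardsCs; congr (_ - _).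
by apply: eq_card => u; rewrite !inE negbK.
Qed.

Definition unstraightened w p := hit w p && ~~ straightened P C w p.

Lemma unstraightened_refill p q s w : hit w p -> hit w q -> ~~ overlap p q ->
  unstraightened (refill p s w) q = unstraightened w q.
Proof.
move=> hit_p hit_q disj; have at_q := at_pos_refill_disjoint s w disj.
rewrite /unstraightened /hit at_q -/(hit w q) hit_q /=.
have [u forms_u] := existsP hit_q; rewrite (straightenedE forms_u).
have := forms_u; rewrite -at_q => /straightenedE ->.
by rewrite right_polarized_refill.
Qed.

Lemma card_unstraightened p w : hit w p ->
  #|[set s | unstraightened (refill p s w) p]| = c`! - #|P|.
Proof.
move=> hit_p; have [u forms_u] := existsP hit_p.
rewrite -(card_not_good (right_polarized w p)).
(* The formed permutation [s * u] runs over ['S_c] as [s] does. *)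
rewrite -[RHS](card_preimset _ (mulIg u)); apply: eq_card => s; rewrite !inE.
rewrite /unstraightened hit_refill hit_p.
rewrite (straightenedE (forms_refill s forms_u)).
by rewrite (right_polarized_same_outside (same_outside_refill _ _ _)).
Qed.

(** * Straightening steps generate the [P]-equivalence *)

Lemma straightenable w p : hit w p ->
  exists w', P_rearr_at P p w w' /\ straightened P C w' p.
Proof.
case/existsP=> u forms_u.
have /eqP/cards1P[u' eq_u'] :=
  card_good_part (right_polarized w p) (pblockT_mem u).
have: u' \in [set v in pblock P u | good (right_polarized w p) v].
  by rewrite eq_u' set11.
rewrite inE => /andP[in_u good_u']; exists (refill p (u' * u^-1) w); split.
  exact: P_rearr_at_refill.
have := forms_refill (u' * u^-1)%g forms_u; rewrite mulgKV => /straightenedE ->.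
by rewrite (right_polarized_same_outside (same_outside_refill _ _ _)).
Qed.

(** Both hits are translates of [u] with the same letter sum, and the sum determines the shift. *)
Lemma same_outside_forms_inj p w w' u : same_outside p w w' ->
  forms (at_pos w p) u -> forms (at_pos w' p) u -> w = w'.
Proof.
case/and3P=> /eqP eq_take /eqP eq_drop eq_at fu fu'.
have eq_pos : at_pos w' p = at_pos w p.
  move: eq_at; case/at_pos_forms: fu => k ->; case/at_pos_forms: fu' => k' ->.
  move/perm_sumn; have sumnD j : sumn [seq y + j | y : nat <- word u]
    = sumn (word u) + j * c.
    transitivity (sumn (word u) + j * size (word u)); last by rewrite size_word.
    by elim: (word u) => [|y v IHv] /=; lia.
  by rewrite !sumnD => /addnI/eqP; rewrite eqn_pmul2r // => /eqP->.
have split_word (x : 'S_n) : word x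
  = take p (word x) ++ at_pos x p ++ drop (p + c) (word x).
  by rewrite addnC -drop_drop !cat_take_drop.
apply/permP => i; apply: val_inj; rewrite /= -!nth_word.
by rewrite (split_word w) (split_word w') eq_take eq_pos eq_drop.
Qed.

Lemma P_rearr_at_eucl w w' w'' p :
  P_rearr_at P p w w' -> P_rearr_at P p w w'' -> P_rearr_at P p w' w''.
Proof.
move=> rearr' rearr''; have [u [u' [fu fu']]] := P_rearr_at_forms rearr'.
have [_ [u'' [_ fu'']]] := P_rearr_at_forms rearr''.
move: rearr' rearr''; rewrite (P_rearr_atE fu fu') (P_rearr_atE fu fu'').
rewrite (P_rearr_atE fu' fu'') => /andP[/and3P[/eqP t1 /eqP d1 p1] in_u'].
case/andP=> /and3P[/eqP t2 /eqP d2 p2] in_u''.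
rewrite (same_pblock (partition_trivIset partP) in_u') in_u'' andbT.
by rewrite /same_outside t1 t2 d1 d2 !eqxx (perm_trans p2) // perm_sym.
Qed.

Lemma P_rearr_at_refl w w' p : P_rearr_at P p w w' -> P_rearr_at P p w w.
Proof.
move=> /P_rearr_at_forms[u [_ [fu _]]].
by rewrite (P_rearr_atE fu fu) /same_outside !eqxx perm_refl mem_pblockT.
Qed.

Lemma P_rearr_at_sym w w' p : P_rearr_at P p w w' -> P_rearr_at P p w' w.
Proof.
by move=> rearr; apply: P_rearr_at_eucl rearr (P_rearr_at_refl rearr).
Qed.

Local Notation step := (@straightening_step n c P C).

(** A straightening step is a rearrangement. Conversely, the two ends of a rearrangement at [p]
    reach a common word [w''], straightened at [p], in at most one step each. *)
Lemma connect_step_rearr :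
  connect (fun w w' => step w w' || step w' w) =2 @P_equiv n c P.
Proof.
move=> w w'; apply/idP/idP; apply: connect_sub => {}w {}w'.
  case/orP=> /existsP[p /and4P[_ _ rearr _]]; apply: connect1; apply/existsP;
    exists p => //.
  exact: P_rearr_at_sym.
case/existsP=> p rearr; have [u [_ [fu _]]] := P_rearr_at_forms rearr.
have hit_p : hit w p by apply/existsP; exists u.
have [w'' [rearr'' str'']] := straightenable hit_p.
have to_w'' (x : 'S_n) : P_rearr_at P p x w'' ->
    connect (fun w w' => step w w' || step w' w) x w''.
  move=> rearr_x; have [v [v'' [fv fv'']]] := P_rearr_at_forms rearr_x.
  have hit_x : hit x p by apply/existsP; exists v.
  case: (boolP (straightened P C x p)) => [str_x|nstr_x]; last first.
    by apply: connect1; apply/orP; left; apply/existsP; exists p;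
      rewrite P_hitE hit_x nstr_x rearr_x.
  (* Both words are straightened at [p] with the same polarization and part, and that part has only
     one good permutation. *)
  suff -> : x = w'' by exact: connect0.
  move: str_x str''; rewrite (straightenedE fv) (straightenedE fv'').
  move: rearr_x; rewrite (P_rearr_atE fv fv'') => /andP[same in_v].
  rewrite -(right_polarized_same_outside same) => good_v good_v''.
  have /eqP/cards1P[v0 eq_v0] :=
    card_good_part (right_polarized w'' p) (pblockT_mem v).
  have v_eq : v = v0 by apply/set1P; rewrite -eq_v0 inE mem_pblockT.
  have v''_eq : v'' = v0 by apply/set1P; rewrite -eq_v0 inE in_v.
  by rewrite v_eq -v''_eq in fv; exact: same_outside_forms_inj same fv fv''.
apply: connect_trans (to_w'' w rearr'') _.
rewrite sym_connect_sym; last by move=> x y; rewrite orbC.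
exact: to_w'' (P_rearr_at_eucl rearr rearr'').
Qed.

Lemma straightening_step_neq w w' : step w w' -> w != w'.
Proof.
by case/existsP=> p /and4P[_ nstr _ str]; apply: contraNneq nstr => ->.
Qed.

Lemma sinkE w : [forall w', ~~ step w w']
  = ([set p | unstraightened w p] == set0).
Proof.
apply/forallP/eqP => [sink|U0 w'].
  apply/setP => p; rewrite !inE; apply/negP => /andP[hit_p nstr].
  have [w' [rearr str]] := straightenable hit_p.
  by have /existsP[] := sink w'; exists p; rewrite P_hitE hit_p nstr rearr.
apply/existsP => -[p /and4P[hit_p nstr _ _]].
by have := in_set0 p; rewrite -U0 inE /unstraightened -P_hitE hit_p nstr.
Qed.

End Straightening.

End Blocks.

(** * Inclusion-exclusion over sets of unstraightened hits *)

Theorem theorem2p8 (n c : nat) (P : {set {set 'S_c}}) (C : {set 'S_c})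
  (c_gt0 : 0 < c) (le_cn : c <= n)
  (partP : partition P [set: 'S_c])
  (strC : straightening_set P C)
  (confC : C_confluent n P C)
  (overlapC : forall (w : 'S_n) (p q : 'I_(n - c).+1),
     p != q -> P_hit P w p -> P_hit P w q -> overlap p q ->
     straightened P C w p || straightened P C w q) :
  let k : rat := ((c`!)%:R - #|P|%:R)%R in
  (#|P_classes n P|%:R : rat)%R =
  (\sum_(0 <= j < n.+1 | (c * j <= n)%N)
     ((-1) ^+ j * ((n - c * j + j)`!%:R) ^+ 2 * k ^+ j)
     / ((j`!)%:R * ((n - c * j)`!)%:R))%R.
Proof.
move=> k; have -> : P_classes n P = components (@straightening_step n c P C).
  apply: eq_imset => w; apply/setP => w'; rewrite !inE.
  by rewrite (connect_step_rearr c_gt0 le_cn partP strC).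
rewrite (card_components (@straightening_step_neq n c P C) confC).
pose U (w : 'S_n) : {set 'I_(n - c).+1} := [set p | unstraightened P C w p].
have card_sub (J : {set 'I_(n - c).+1}) :
    ((#|[set w | J \subset U w]|%:R : rat)
      = if spread J then k ^+ #|J| * ((n - c.-1 * #|J|)`!)%:R else 0)%R.
  case: ifPn => [spJ|nspJ]; last first.
    (* Two overlapping hits of [J], both unstraightened in one word, would contradict [overlapC]. *)
    rewrite (_ : [set w | _] = set0) ?cards0 //; apply/setP => w; rewrite !inE.
    apply: contraNF nspJ => /subsetP sJU; apply/forall_inP => p pJ;
      apply/forall_inP => q qJ.
    apply/implyP => lt_pq; rewrite leqNgt; apply/negP => lt_qpc.
    have := sJU p pJ; have := sJU q qJ;
      rewrite !inE => /andP[hit_q nstr_q] /andP[hit_p nstr_p].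
    have := overlapC w p q; rewrite !P_hitE // hit_p hit_q overlapE //.
    rewrite (negbTE nstr_p) (negbTE nstr_q) => bad; apply: notF;
      apply: bad => //.
      by rewrite neq_ltn lt_pq.
    by rewrite lt_qpc; have := ltn_ord p; lia.
  have card_U := @card_refill n c c_gt0 le_cn J
    (fun p w => unstraightened P C w p) (c`! - #|P|) spJ.
  have eq_card_U : c`! ^ #|J| * #|[set w | J \subset U w]|
      = (c`! - #|P|) ^ #|J| * #|hits_at J|.
    rewrite -card_U; last 2 first.
    - move=> p q s w pJ qJ neq_pq; rewrite inE => /forall_inP hitsJ.
      by apply: unstraightened_refill;
        rewrite ?hitsJ // (spread_overlap c_gt0 le_cn spJ).
    - move=> p w pJ; rewrite inE => /forall_inP hitsJ.
      by apply: card_unstraightened; rewrite ?hitsJ.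
    congr (_ * _); apply: eq_card => w; rewrite !inE.
    apply/subsetP/andP => [sJU|[_ /forall_inP sJU] p pJ];
      last by rewrite inE sJU.
    have unstr_J p : p \in J -> unstraightened P C w p.
      by move=> /sJU; rewrite inE.
    by split; apply/forall_inP => p /unstr_J // /andP[].
  move: eq_card_U; rewrite (card_hits_at c_gt0 le_cn spJ) mulnCA => /eqP.
  rewrite eqn_pmul2l ?expn_gt0 ?fact_gt0 // => /eqP->.
  have le_P : #|P| <= c`!.
    by rewrite -(card_good partP strC true) -card_Sn max_card.
  by rewrite natrM natrX natrB.
have -> : (#|[set w | [forall w', ~~ @straightening_step n c P C w w']]|%:R
   = \sum_(J : {set 'I_(n - c).+1})
       (-1) ^+ #|J| * #|[set w | J \subset U w]|%:R :> rat)%R.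
  transitivity (\sum_(w : 'S_n) (U w == set0)%:R : rat)%R.
    rewrite -natr_sum -sum1_card big_mkcond; congr (_%:R)%R;
      apply: eq_bigr => w _.
    by rewrite inE (sinkE c_gt0 le_cn partP strC); case: (_ == _).
  under eq_bigr => w _ do rewrite -sum_subset_sign big_mkcond.
  rewrite exchange_big /=; apply: eq_bigr => J _.
  rewrite -(sum1_card (mem [set w | J \subset U w])) natr_sum mulr_sumr.
  by rewrite [RHS]big_mkcond; apply: eq_bigr => w _; rewrite !inE mulr1.
under eq_bigr => J _ do rewrite card_sub.
have le_J (J : {set 'I_(n - c).+1}) : #|J| < n.+1.
  by apply: leq_ltn_trans (max_card _) _; rewrite card_ord; lia.
(* Group the sets [J] by cardinal; the summand depends on nothing else once [J] is spread. *)
rewrite (partition_big (fun J => Ordinal (le_J J)) predT) //=.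
rewrite [RHS]big_mkcond big_mkord.
apply: eq_bigr => j _.
transitivity ((if c * j <= n then 'C(n - c * j + j, j) else 0)%N%:R
    * ((-1) ^+ j * (k ^+ j * ((n - c.-1 * j)`!)%:R)) : rat)%R.
  rewrite -(@card_spread (n - c).+1); try lia.
  rewrite -sum1_card natr_sum mulr_suml [LHS]big_mkcond [RHS]big_mkcond;
    apply: eq_bigr => J _.
  rewrite !inE -val_eqE /= /spread.
  have -> : [forall p in J, p + c <= n].
    by apply/forall_inP => p _; have := ltn_ord p; lia.
  case: eqVneq => [->|] //=; case: ifP => _; rewrite ?mul1r ?mulr0 //.
case: leqP => [le_cj|]; last by rewrite mul0r.
have -> : n - c.-1 * j = n - c * j + j by nia.
set a := n - c * j.
(* The binomial supplies the second factor (a + j)! of the square, together with the denominator j!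
   a!. *)
have := bin_fact (leq_addl a j); rewrite addnK => <-.
rewrite !natrM; have := fact_gt0 j; have := fact_gt0 a;
  rewrite -!(ltr0n rat) => a0 j0.
field.
by rewrite !lt0r_neq0.
Qed.
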